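(* For each integer $t\ge 0$ we have $n_2(3,3+4t,2)=6+7t$, $n_2(3,4+4t,2)=7+7t$, $n_2(3,5+4t,2)=10+7t$, and $n_2(3,6+4t,2)=11+7t$. Moreover, $n_2(3,1,2)=n_2(3,2,2)=5$.
   Context: An $[n,k,d]_q$-code is a $k$-dimensional subspace of $\mathbb{F}_q^n$ with minimum Hamming distance at least $d$. A linear code $C\subseteq\mathbb{F}_q^n$ has locality $r$ if for every coordinate $i$ there is a set $S_i\subseteq\{1,\dots,n\}\setminus\{i\}$ with $|S_i|\le r$ such that any two codewords agreeing on all coordinates in $S_i$ also agree in coordinate $i$. $n_q(k,d,r)$ denotes the minimum length $n$ of an $[n,k,d]_q$-code with locality $r$. *)

(* Defs.v *)
From HB Require Import structures.
From mathcomp Require Export all_boot all_order all_algebra.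

Set Implicit Arguments.
Unset Strict Implicit.
Unset Printing Implicit Defensive.

Import GRing.Theory.
Local Open Scope ring_scope.

Definition hamming_dist (F : finFieldType) (n : nat) (x y : 'rV[F]_n) : nat :=
  #|[set i : 'I_n | x 0 i != y 0 i]|.

Definition min_dist_ge (F : finFieldType) (n : nat)
    (C : {vspace 'rV[F]_n}) (d : nat) : Prop :=
  forall x y : 'rV[F]_n, x \in C -> y \in C -> x != y ->
    (d <= hamming_dist x y)%N.

Definition is_code (F : finFieldType) (n k d : nat)
    (C : {vspace 'rV[F]_n}) : Prop :=
  \dim C = k /\ min_dist_ge C d.

Definition has_locality (F : finFieldType) (n : nat)
    (C : {vspace 'rV[F]_n}) (r : nat) : Prop :=
  forall i : 'I_n, exists S : {set 'I_n},
    [/\ i \notin S, (#|S| <= r)%N &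
        forall x y : 'rV[F]_n, x \in C -> y \in C ->
          (forall j : 'I_n, j \in S -> x 0 j = y 0 j) -> x 0 i = y 0 i].

Definition lrc_exists (F : finFieldType) (k d r n : nat) : Prop :=
  exists C : {vspace 'rV[F]_n}, is_code k d C /\ has_locality C r.

(* [min_lrc_length F k d r n] reads n_q(k,d,r) = n, where q = #|F|.  It is a
   relation because no code need exist for arbitrary parameters (for example
   r = 0 and k > 0), so n_q is only a partial function. *)
Definition min_lrc_length (F : finFieldType) (k d r n : nat) : Prop :=
  lrc_exists F k d r n /\
  forall m : nat, lrc_exists F k d r m -> (n <= m)%N.

(* Main.v *)
Require Import Defs.
From mathcomp Require Import all_boot all_order all_algebra.
From mathcomp Require Import zify.

(** Lower bounds: at every coordinate at most four of the seven nonzero words of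
    a three-dimensional binary code are nonzero, so 7d <= 4n.  The weights of
    x, y and x + y have an even sum, so for odd d each of the seven
    two-dimensional subcodes has total weight at least 3d + 1, which improves
    the bound to 21d + 7 <= 12n.  For d <= 2 the locality is what matters: in
    dimension r + 1 there is a nonzero word vanishing on r coordinates that
    repair a further one, and if n <= r + 2 it has only one other coordinate,
    which its own repair set forces to vanish too.

    Upper bounds: repeat cyclically the seven points of the Fano plane, the four
    points off a line first; all the optimal codes are prefixes of this
    sequence. *)

Set Implicit Arguments.
Unset Strict Implicit.
Unset Printing Implicit Defensive.

Import GRing.Theory.
Local Open Scope ring_scope.

(** * Lower bound on the length from locality *)

(** The projection [f] onto the coordinates in [S] has rank at most [#|S|], so its kernel meets [C]
    nontrivially. *)
Lemma exists_word_vanishing_on (F : finFieldType) (n : nat)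
    (C : {vspace 'rV[F]_n}) (S : {set 'I_n}) :
  (#|S| < \dim C)%N ->
  exists x : 'rV[F]_n,
    [/\ x \in C, x != 0 & forall j, j \in S -> x 0 j = 0].
Proof.
move=> ltSC.
pose f : 'Hom('rV[F]_n, 'rV[F]_#|S|) :=
  linfun (mulmxr (\matrix_(i, j) ((i == enum_val j)%:R : F))).
have fE x j : f x 0 j = x 0 (enum_val j).
  rewrite lfunE /= mxE (bigD1 (enum_val j)) //= mxE eqxx mulr1 big1 ?addr0 //.
  by move=> i /negPf ne; rewrite mxE ne mulr0.
have dimf : (\dim (f @: C) <= #|S|)%N.
  by rewrite (leq_trans (dimvS (subvf _))) // dimvf /dim /= mul1n.
have dimK : (0 < \dim (C :&: lker f))%N.
  rewrite lt0n; apply: contraL ltSC => /eqP dimK0.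
  by rewrite -(limg_ker_dim f C) dimK0 -leqNgt.
exists (vpick (C :&: lker f)).
have := memv_pick (C :&: lker f); rewrite memv_cap => /andP[xC].
rewrite memv_ker => /eqP fx0; split=> // [|j jS].
  by rewrite vpick0 -dimv_eq0 -lt0n.
by rewrite -[j](enum_rankK_in jS jS) -fE fx0 mxE.
Qed.

(** Repair sets may be smaller than [r]; padding them to exactly [r] elements makes the counting
    below exact. *)
Lemma card_extend_avoiding (T : finType) (S : {set T}) (i : T) (r : nat) :
  i \notin S -> (#|S| <= r < #|T|)%N ->
  exists S' : {set T}, [/\ S \subset S', i \notin S' & #|S'| = r].
Proof.
move=> iS /andP[leSr ltrT].
pose s := enum S ++ enum (~: (i |: S)).
have us : uniq s.
  rewrite cat_uniq !enum_uniq andbT /=; apply/hasPn => x.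
  by rewrite !mem_enum !inE negb_or => /andP[].
have sz_s : size s = #|T|.-1.
  rewrite size_cat -!cardE; have := cardsC (i |: S); rewrite cardsU1 iS; lia.
exists [set x in take r s]; split.
- apply/subsetP=> x xS; rewrite inE take_cat -cardE ltnNge leSr /=.
  by rewrite mem_cat mem_enum xS.
- rewrite inE; apply/negP => /mem_take.
  by rewrite mem_cat !mem_enum !inE eqxx (negPf iS).
- rewrite cardsE (card_uniqP _) ?take_uniq // size_takel // sz_s; lia.
Qed.

Lemma locality_length_ge (F : finFieldType) (n r : nat)
    (C : {vspace 'rV[F]_n}) :
  \dim C = r.+1 -> has_locality C r -> (r.+3 <= n)%N.
Proof.
move=> dimC locC; rewrite leqNgt; apply/negP => ltn.
have len : (r < n)%N.
  by have := dimvS (subvf C); rewrite dimC dimvf /dim /= mul1n.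
pose i : 'I_n := Ordinal len.
have [S [iS cS detS]] := locC i.
have [|S' [sSS' iS' cS']] := @card_extend_avoiding _ S i r iS.
  by rewrite cS card_ord.
have [|x [xC x0 xS]] := @exists_word_vanishing_on F n C S'.
  by rewrite cS' dimC.
have zero : (0 : 'rV[F]_n) \in C by apply: mem0v.
have xi : x 0 i = 0.
  rewrite (detS x 0 xC zero) ?mxE // => j jS.
  by rewrite xS ?mxE // (subsetP sSS').
have [j xj] : exists j, x 0 j != 0.
  apply/existsP; apply: contraR x0; rewrite negb_exists => /forallP x0.
  by apply/eqP/rowP => j; rewrite mxE; apply/eqP; rewrite -[_ == _]negbK x0.
have suppD l : x 0 l != 0 -> l \notin i |: S'.
  apply: contraR; rewrite negbK in_setU1 => /orP[/eqP-> | /xS ->] //.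
  by rewrite xi.
have [Sj [jSj _ detj]] := locC j.
move/negP: (xj); apply; rewrite (detj x 0 xC zero) ?mxE // => l lSj.
rewrite mxE; apply/eqP; apply/negPn/negP => xl.
have ljn : l != j by apply: contraNneq jSj => <-.
(* The distinct support positions [l] and [j] lie outside the [r.+1] zeros in [i |: S'], which makes
   [r.+3] coordinates. *)
have : (#|[set l; j] :|: (i |: S')| <= n)%N.
  by rewrite -[X in (_ <= X)%N]card_ord max_card.
rewrite -setUA !cardsU1 in_setU1 negb_or ljn (suppD l xl) iS' cS'.
by rewrite suppD //=; lia.
Qed.

(** * Lower bounds on the length from weights of binary words *)

Lemma F2_cases (P : 'F_2 -> Prop) : P 0 -> P 1 -> forall a, P a.
Proof.
move=> P0 P1 [[|[|//]] lt2]; [move: P0 | move: P1]; congr P; exact: val_inj.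
Qed.

Lemma hamming_dist0E (F : finFieldType) (n : nat) (x : 'rV[F]_n) :
  hamming_dist x 0 = (\sum_i (x 0%R i != 0%R))%N.
Proof.
rewrite /hamming_dist -sum1_card big_mkcond /=.
by apply: eq_bigr => i _; rewrite inE mxE; case: eqP.
Qed.

(** In each coordinate, either none or exactly two of the three bits are 1. *)
Lemma F2_weight_sum3_even (n : nat) (x y : 'rV['F_2]_n) :
  ~~ odd (hamming_dist x 0 + hamming_dist y 0 + hamming_dist (x + y) 0).
Proof.
rewrite !hamming_dist0E -!big_split /=.
elim/big_ind: _ => [//|p q|i _].
  by rewrite [in X in _ -> _ -> X]oddD => /negPf-> /negPf->.
by rewrite mxE; move: (x 0 i) (y 0 i); do 2![elim/F2_cases].
Qed.

Lemma F2_weight_sum7_le (n : nat) (x y z : 'rV['F_2]_n) :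
  (hamming_dist x 0 + hamming_dist y 0 + hamming_dist z 0
   + hamming_dist (x + y)%R 0 + hamming_dist (x + z)%R 0
   + hamming_dist (y + z)%R 0 + hamming_dist (x + y + z)%R 0 <= 4 * n)%N.
Proof.
rewrite !hamming_dist0E -!big_split /=.
have -> : (4 * n = \sum_(i < n) 4)%N by rewrite sum_nat_const card_ord mulnC.
apply: leq_sum => i _; rewrite !mxE.
by move: (x 0 i) (y 0 i) (z 0 i); do 3![elim/F2_cases].
Qed.

Lemma F2_addrr (n : nat) (x : 'rV['F_2]_n) : x + x = 0.
Proof.
by apply/rowP => i; rewrite !mxE; elim/F2_cases: (x 0 i); apply/val_inj.
Qed.

Lemma F2_dim3_words (n : nat) (C : {vspace 'rV['F_2]_n}) :
  \dim C = 3 -> exists x y z : 'rV['F_2]_n, [/\ x \in C, y \in C, z \in C &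
    forall a b c : 'F_2,
      a *: x + b *: y + c *: z = 0 -> [/\ a = 0, b = 0 & c = 0]].
Proof.
move=> dimC; have := vbasisP C; have := @vbasis_mem _ _ ^~ C.
move: (vbasis C); rewrite dimC => X memX /andP[_ /freeP freeX].
exists X`_0, X`_1, X`_2; split; try by apply/memX/mem_nth; rewrite size_tuple.
move=> a b c abc0.
have := freeX (fun i => nth 0 [:: a; b; c] i).
rewrite !big_ord_recl big_ord0 addr0 addrA.
move=> /(_ abc0) k0.
by split; [exact: (k0 ord0) | exact: (k0 (lift ord0 ord0)) | exact: (k0 ord_max)].
Qed.

(** For odd [d] the obvious bound [3 * d] is odd, so an even sum cannot attain it. *)
Lemma even_sum3_ge_odd (d p q r : nat) :
  (d <= p -> d <= q -> d <= r -> ~~ odd (p + q + r) -> odd d ->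
   3 * d + 1 <= p + q + r)%N.
Proof. lia. Qed.

Lemma F2_dim3_length_ge (n d : nat) (C : {vspace 'rV['F_2]_n}) :
  is_code 3 d C ->
  (7 * d <= 4 * n)%N /\ (odd d -> 21 * d + 7 <= 12 * n)%N.
Proof.
move=> [/F2_dim3_words[x [y [z [xC yC zC free]]]] distC].
have wt_ge u : u \in C -> u != 0 -> (d <= hamming_dist u 0)%N.
  by move=> uC; apply: distC => //; apply: mem0v.
have nz a b c u : a *: x + b *: y + c *: z = u ->
    ~~ [&& a == 0, b == 0 & c == 0] -> u != 0.
  by move=> <-; apply: contraNneq => /free[-> -> ->]; rewrite eqxx.
have nzx := nz 1 0 0 x; have nzy := nz 0 1 0 y; have nzz := nz 0 0 1 z.
have nzxy := nz 1 1 0 (x + y); have nzxz := nz 1 0 1 (x + z).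
have nzyz := nz 0 1 1 (y + z); have nzxyz := nz 1 1 1 (x + y + z).
rewrite ?scale1r ?scale0r ?addr0 ?add0r in nzx nzy nzz nzxy nzxz nzyz nzxyz.
have wx := wt_ge _ xC (nzx erefl isT); have wy := wt_ge _ yC (nzy erefl isT).
have wz := wt_ge _ zC (nzz erefl isT).
have wxy := wt_ge _ (memvD xC yC) (nzxy erefl isT).
have wxz := wt_ge _ (memvD xC zC) (nzxz erefl isT).
have wyz := wt_ge _ (memvD yC zC) (nzyz erefl isT).
have wxyz := wt_ge _ (memvD (memvD xC yC) zC) (nzxyz erefl isT).
have sum7 := F2_weight_sum7_le x y z.
(* The seven nonzero words form a Fano plane; [l1] to [l7] run through its lines, that is, the
   two-dimensional subcodes. *)
have l1 := F2_weight_sum3_even x y; have l2 := F2_weight_sum3_even x z.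
have l3 := F2_weight_sum3_even y z; have l4 := F2_weight_sum3_even (x + y) z.
have l5 := F2_weight_sum3_even x (y + z); have l6 := F2_weight_sum3_even y (x + z).
have l7 := F2_weight_sum3_even (x + y) (y + z).
have e7 : x + y + (y + z) = x + z by rewrite addrA -(addrA x) F2_addrr addr0.
rewrite addrA in l5; rewrite addrCA addrA in l6; rewrite e7 in l7.
have line := @even_sum3_ge_odd d.
split=> [|odd_d].
  by apply: leq_trans sum7; rewrite !mulSn mul0n addn0 !addnA !leq_add.
(* Each word lies on three lines, so adding the seven line bounds gives 7(3d + 1) <= 3 * 4n. *)
move: (line _ _ _ wx wy wxy l1 odd_d) (line _ _ _ wx wz wxz l2 odd_d)
  (line _ _ _ wy wz wyz l3 odd_d) (line _ _ _ wxy wz wxyz l4 odd_d)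
  (line _ _ _ wx wyz wxyz l5 odd_d) (line _ _ _ wy wxz wxyz l6 odd_d)
  (line _ _ _ wxy wyz wxz l7 odd_d) sum7.
move: (hamming_dist x 0) (hamming_dist y 0) (hamming_dist z 0).
move: (hamming_dist (x + y) 0) (hamming_dist (x + z) 0) (hamming_dist (y + z) 0).
by move: (hamming_dist (x + y + z) 0); clear; lia.
Qed.

(** * Codes from the periodic Fano sequence *)

Definition fano_rows : seq (seq nat) :=
  [:: [:: 0; 1; 0; 1; 1; 0; 1];
      [:: 0; 0; 1; 1; 0; 1; 1];
      [:: 1; 1; 1; 1; 0; 0; 0]]%N.

Definition fano_mx (n : nat) : 'M['F_2]_(3, n) :=
  \matrix_(i, j) (nth 0 (nth [::] fano_rows i) (j %% 7))%:R.

(** Indexing by [nat] instead of ['I_n] turns weights into counts over [iota], which are periodic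
    and can be computed. *)
Definition fano_word (a b c : 'F_2) (j : nat) : 'F_2 :=
  a *+ nth 0%N (nth [::] fano_rows 0) (j %% 7)
  + b *+ nth 0%N (nth [::] fano_rows 1) (j %% 7)
  + c *+ nth 0%N (nth [::] fano_rows 2) (j %% 7).

Definition fano_code (n : nat) : {vspace 'rV['F_2]_n} :=
  limg (linfun (mulmxr (fano_mx n))).

Lemma mul_fano_mxE (n : nat) (u : 'rV['F_2]_3) (j : 'I_n) :
  (u *m fano_mx n) 0 j = fano_word (u 0 0) (u 0 1) (u 0 2%:R) j.
Proof.
rewrite mxE !big_ord_recl big_ord0 addr0 addrA !mxE !mulr_natr.
by congr (_ *+ _ + _ *+ _ + _ *+ _); congr (u 0 _); apply: val_inj.
Qed.

Lemma count_iota_periodic (p : pred nat) (k s t : nat) :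
  (forall j, p (k + j)%N = p j) ->
  count p (iota 0 (s + k * t)) =
  (count p (iota 0 s) + count p (iota 0 k) * t)%N.
Proof.
move=> per; elim: t => [|t IHt]; first by rewrite !muln0 !addn0.
have shift m : iota k m = map (addn k) (iota 0 m) by rewrite -iotaDl addn0.
rewrite !mulnS addnCA iotaD count_cat add0n shift count_map.
by rewrite (eq_count (per : preim (addn k) p =1 p)) IHt addnCA.
Qed.

Lemma fano_weightE (n : nat) (u : 'rV['F_2]_3) :
  hamming_dist (u *m fano_mx n) 0 =
  count (fun j => fano_word (u 0 0) (u 0 1) (u 0 2%:R) j != 0) (iota 0 n).
Proof.
rewrite hamming_dist0E -sum1_count [RHS]big_mkcond /=.
have -> : iota 0 n = index_iota 0 n by rewrite /index_iota subn0.
rewrite big_mkord; apply: eq_bigr => j _.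
by rewrite mul_fano_mxE; case: (_ == _).
Qed.

(** Over a full period every nonzero word has weight exactly 4 (the simplex code), so only the first
    [s] positions need checking. *)
Lemma fano_weight_ge (s t d : nat) (u : 'rV['F_2]_3) :
  (forall a b c : 'F_2, ~~ [&& a == 0, b == 0 & c == 0] ->
     (d <= count (fun j => fano_word a b c j != 0%R) (iota 0 s))%N) ->
  u != 0 -> (d + 4 * t <= hamming_dist (u *m fano_mx (s + 7 * t)) 0)%N.
Proof.
move=> ds u0; rewrite fano_weightE count_iota_periodic; last first.
  by move=> j; rewrite /fano_word modnDl.
have : ~~ [&& u 0 0 == 0, u 0 1 == 0 & u 0 2%:R == 0].
  apply: contraNN u0 => /and3P[/eqP u0 /eqP u1 /eqP u2]; apply/eqP/rowP.
  move=> [[|[|[|//]]] lt3]; rewrite !mxE; [move: u0 | move: u1 | move: u2];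
    by move=> <-; congr (u 0 _); apply: val_inj.
move: (u 0 0) (u 0 1) (u 0 2%:R) => a b c abc; apply: leq_add; first exact: ds.
by move: a b c abc; do 3![elim/F2_cases].
Qed.

(** The bound [d.+1] is positive, so the encoding map is injective and the dimension is 3. *)
Lemma fano_code_is_code (n d : nat) :
  (forall u : 'rV['F_2]_3, u != 0 ->
     (d.+1 <= hamming_dist (u *m fano_mx n) 0)%N) ->
  is_code 3 d.+1 (fano_code n).
Proof.
move=> wt_ge; split.
  rewrite limg_dim_eq ?dimvf //; apply/eqP; rewrite -subv0; apply/subvP=> u.
  rewrite memv_cap memvf memv_ker lfunE /= memv0 => /eqP uG0.
  apply: contraT => /wt_ge; rewrite uG0 hamming_dist0E big1 // => i _.
  by rewrite mxE eqxx.
move=> _ _ /memv_imgP[u _ ->] /memv_imgP[v _ ->]; rewrite !lfunE /= => neq.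
have : u - v != 0 by apply: contraNneq neq => /subr0_eq ->.
move/wt_ge; rewrite mulmxBl /hamming_dist => /leq_trans; apply.
by apply/subset_leq_card/subsetP => i; rewrite !inE !mxE subr_eq0.
Qed.

(* Position [j] of the Fano sequence is the sum of these two positions. *)
Definition fano_line (j : nat) : nat * nat :=
  nth (0, 0)%N [:: (1, 4); (0, 4); (3, 4); (2, 4); (0, 1); (0, 2); (4, 5)]%N j.

Lemma fano_code_locality (n : nat) : (5 <= n)%N -> has_locality (fano_code n) 2.
Proof.
move=> n5 i; have [i7|i7] := leqP 7 i.
  (* From position 7 on, a coordinate is repaired by its copy one period earlier. *)
  have lt_in : (i - 7 < n)%N by apply: leq_ltn_trans (ltn_ord i); apply: leq_subr.
  exists [set Ordinal lt_in]; rewrite cards1 inE; split=> //.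
    by apply/eqP=> /(congr1 val) /=; lia.
  move=> _ _ /memv_imgP[u _ ->] /memv_imgP[v _ ->]; rewrite !lfunE /=.
  move/(_ _ (set11 _)); rewrite !mul_fano_mxE /fano_word /=.
  by rewrite -[in X in _ -> X](subnK i7) !modnDr.
(* The lines chosen use positions below 5, except that position 6 also uses 5, which is below [n]
   once 6 is. *)
have lt_l : ((fano_line i).1 < n)%N && ((fano_line i).2 < n)%N.
  move: (i : nat) i7 (ltn_ord i).
  by do 7![case=> [|]; first by move=> _ lt_in /=; lia].
have [lt1 lt2] := andP lt_l.
exists [set Ordinal lt1; Ordinal lt2]; split.
- rewrite !inE -!val_eqE /=; move: (i : nat) i7; by do 7![case=> [//|]].
- by rewrite cards2; case: (_ != _).
move=> _ _ /memv_imgP[u _ ->] /memv_imgP[v _ ->]; rewrite !lfunE /= => eq_uv.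
have := eq_uv (Ordinal lt1); have := eq_uv (Ordinal lt2).
rewrite !inE !eqxx orbT /= => /(_ isT) e2 /(_ isT) e1; move: e1 e2.
rewrite !mul_fano_mxE /=.
have line a b c : fano_word a b c i =
    fano_word a b c (fano_line i).1 + fano_word a b c (fano_line i).2.
  move: (i : nat) i7 a b c.
  by do 7![case=> [_|]; first by do 3![elim/F2_cases]; apply/val_inj].
by rewrite !line => -> ->.
Qed.

Lemma fano_lrc_exists (s t d : nat) : (5 <= s)%N -> (0 < d)%N ->
  (forall a b c : 'F_2, ~~ [&& a == 0, b == 0 & c == 0] ->
     (d <= count (fun j => fano_word a b c j != 0%R) (iota 0 s))%N) ->
  lrc_exists 'F_2 3 (d + 4 * t) 2 (s + 7 * t).
Proof.
case: d => // d s5 _ ds; exists (fano_code (s + 7 * t)); split.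
  by apply: fano_code_is_code => u u0; rewrite -addSn; apply: fano_weight_ge.
by apply: fano_code_locality; apply: leq_trans s5 (leq_addr _ _).
Qed.

Theorem theorem24 :
  (forall t : nat,
     [/\ min_lrc_length 'F_2 3 (3 + 4 * t) 2 (6 + 7 * t),
         min_lrc_length 'F_2 3 (4 + 4 * t) 2 (7 + 7 * t),
         min_lrc_length 'F_2 3 (5 + 4 * t) 2 (10 + 7 * t) &
         min_lrc_length 'F_2 3 (6 + 4 * t) 2 (11 + 7 * t)]) /\
  (min_lrc_length 'F_2 3 1 2 5 /\ min_lrc_length 'F_2 3 2 2 5).
Proof.
split=> [t|].
  (* Rounding up [bound] suffices for all distances but 5 + 4t: there it gives only 9 + 7t, while
     [odd_bound] gives 112/12 + 7t, hence 10 + 7t. *)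
  split; split; try by [apply: fano_lrc_exists => //; do 3![elim/F2_cases]];
    move=> m [C [/F2_dim3_length_ge[bound odd_bound] _]]; try lia.
(* For distances 1 and 2 the weight bounds yield at most 4. *)
have lower d m : lrc_exists 'F_2 3 d 2 m -> (5 <= m)%N.
  by move=> [C [[dimC _] /(locality_length_ge dimC)]].
split; split; try exact: lower.
  by apply: (@fano_lrc_exists 5 0 1) => //; do 3![elim/F2_cases].
by apply: (@fano_lrc_exists 5 0 2) => //; do 3![elim/F2_cases].
Qed.
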